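(* For every $n\ge 1$, the semigroup $\mathrm{Dom}_{T_n}(C_n)$ is idempotent-generated, i.e. every element of it is a finite product of idempotents belonging to $\mathrm{Dom}_{T_n}(C_n)$.
   Context: $X_n=\{1,2,\dots,n\}$ is the finite chain with its usual order, and $T_n$ is the full transformation semigroup of all maps $X_n\to X_n$, written on the right and composed left to right. The Catalan monoid $C_n$ is the subsemigroup of $T_n$ of all maps $\alpha$ that are both order-decreasing ($x\alpha\le x$ for all $x\in X_n$) and order-preserving ($x\le y\Rightarrow x\alpha\le y\alpha$ for all $x,y\in X_n$). For a subsemigroup $U$ of a semigroup $S$, an element $d\in S$ is dominated by $U$ if for every semigroup $T$ and all semigroup homomorphisms $f,g:S\to T$ with $f|_U=g|_U$ one has $(d)f=(d)g$; the dominion $\mathrm{Dom}_S(U)$ is the set of all elements of $S$ dominated by $U$ (a subsemigroup of $S$ containing $U$). *)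

(* Defs.v *)
From HB Require Import structures.
From mathcomp Require Import all_boot.
Set Implicit Arguments.
Unset Strict Implicit.
Unset Printing Implicit Defensive.
Local Open Scope group_scope.

(* An alias: {ffun 'I_n -> 'I_n} itself would be a candidate for the pointwise
   multiplication of finite functions. The chain {1, ..., n} is 'I_n, shifted
   to {0, ..., n - 1}. *)
Definition full_trans (n : nat) := {ffun 'I_n -> 'I_n}.

HB.instance Definition _ n := Finite.on (full_trans n).

Section FullTransformationSemigroup.
Variable n : nat.
Implicit Types a b : full_trans n.

(* Maps act on the right, so a * b is "first a, then b". *)
Definition trans_mul a b : full_trans n := [ffun x => b (a x)].

Fact trans_mulA : associative trans_mul.
Proof. by move=> a b c; apply/ffunP=> x; rewrite !ffunE. Qed.

HB.instance Definition _ := isSemigroup.Build (full_trans n) trans_mulA.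

Definition order_decreasing a := [forall x : 'I_n, (a x <= x)%N].

Definition order_preserving a :=
  [forall x : 'I_n, forall y : 'I_n, (x <= y)%N ==> (a x <= a y)%N].

Definition catalan : {pred full_trans n} :=
  fun a => order_decreasing a && order_preserving a.

Fact catalan_mulg_closed : mulg_closed catalan.
Proof.
move=> a b /andP[/forallP da /forallP pa] /andP[/forallP db /forallP pb].
apply/andP; split; apply/forallP => x.
  by rewrite ffunE (leq_trans (db _) (da x)).
apply/forallP => y; apply/implyP => lexy; rewrite !ffunE.
by apply: (implyP (forallP (pb _) _)); apply: (implyP (forallP (pa _) _)).
Qed.

HB.instance Definition _ :=
  isMulClosed.Build (full_trans n) catalan catalan_mulg_closed.

End FullTransformationSemigroup.

Arguments catalan n : clear implicits.

(* The codomain ranges over all semigroups on arbitrary types: semigroupType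
   would in addition require a choice structure on T. *)
Definition dominion (S : semigroupType) (U : mulgClosed S) (d : S) : Prop :=
  forall T : magmaType, associative (@mul T) ->
  forall f g : {multiplicative S -> T}, {in U, f =1 g} -> f d = g d.

(* The product e * e_1 * ... * e_k, for k >= 0, is nonempty since S need not
   have an identity. *)
Definition idempotent_generated (S : semigroupType) (D : S -> Prop) : Prop :=
  forall d, D d -> exists (e : S) (es : seq S),
    (forall x, x \in e :: es -> D x /\ x * x = x) /\ d = foldl *%g e es.

(* Main.v *)
(* The dominion consists of the order-preserving maps that fix the least point.
   Let [h] be a binary operation on the chain preserved by [C_n]. Conjugating
   the action of [T_n] on pairs [(v, a)] of boolean functions, [v] of two
   variables and [a] of one, by the involution [(v, a) |-> (v xor a o h, a)]
   does not change the action of [C_n]; so dominated maps commute with this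
   involution, which means that they preserve [h]. Take for [h] the minimum and
   the constant least point. Conversely, an idempotent order-preserving map [e]
   fixing the least point is dominated by the zigzag [e = m e], [m = e (p m)],
   [(p m) e = p], where [m x] is the least point of the kernel class of [x] and
   [p x] is the largest fixed point of [e] below [x]. Finally, an
   order-preserving map [d] fixing the least point and different from the
   identity is [d' e], where [d'] moves one value of [d] one step closer to the
   diagonal and the idempotent [e] moves it back. *)
From HB Require Import structures.
Require Import Defs.
From mathcomp Require Import all_boot zify.
Local Open Scope group_scope.
Set Implicit Arguments.
Unset Strict Implicit.
Unset Printing Implicit Defensive.

Section Dominion.
Variables (S : semigroupType) (U : mulgClosed S).
Implicit Types d u x y : S.

(** If [f] and [g] agree on [U], then [f (u0 * y) = g u0 * f y = g x * g u * f y = g x * f (u * y) =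
    g x * g (u * y) = g (u0 * y)]. *)
Lemma dominion_zigzag u0 u x y : u0 \in U -> u \in U -> u * y \in U ->
  x * u = u0 -> dominion U (u0 * y).
Proof.
move=> Uu0 Uu Uuy xu T mA f g fg.
rewrite gmulfM fg // -xu gmulfM -mA -(fg u) // -gmulfM fg // -gmulfM.
by rewrite mulgA.
Qed.

(** The action and its conjugate by [tau] are two homomorphisms into the self-maps of [W] that agree
    on [U]. *)
Lemma dominion_involution (W : finType) (act : S -> W -> W) (tau : W -> W) d :
    (forall s t w, act (s * t) w = act s (act t w)) -> involutive tau ->
    {in U, forall u w, tau (act u w) = act u (tau w)} ->
  dominion U d -> forall w, tau (act d w) = act d (tau w).
Proof.
move=> actM tauK Utau Dd w.
pose mulW (F G : {ffun W -> W}) := [ffun w => F (G w)].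
pose T : magmaType := HB.pack {ffun W -> W} (hasMul.Build {ffun W -> W} mulW).
have mA : associative (@mul T).
  by move=> F G H; apply/ffunP => z; rewrite !ffunE.
pose f0 (s : S) : T := [ffun w => act s w].
pose g0 (s : S) : T := [ffun w => tau (act s (tau w))].
have f0M : {morph f0 : x y / x * y}.
  by move=> s t; apply/ffunP => z; rewrite !ffunE actM.
have g0M : {morph g0 : x y / x * y}.
  by move=> s t; apply/ffunP => z; rewrite !ffunE actM tauK.
pose f : {multiplicative S -> T} :=
  HB.pack f0 (isMultiplicative.Build S T f0 f0M).
pose g : {multiplicative S -> T} :=
  HB.pack g0 (isMultiplicative.Build S T g0 g0M).
have /(congr1 (fun F : {ffun W -> W} => F w)) : f d = g d.
  apply: (Dd T mA f g) => u Uu; apply/ffunP => z /=.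
  by rewrite !ffunE Utau // tauK.
by rewrite /= !ffunE => ->; rewrite tauK.
Qed.

End Dominion.

Section FullTransformations.
Variable n : nat.
Implicit Types (d e : full_trans n) (x y z : 'I_n).

Lemma dominion_preserves_op (U : mulgClosed (full_trans n))
    (h : 'I_n -> 'I_n -> 'I_n) d :
    (forall u : full_trans n, u \in U ->
       forall x y, h (u x) (u y) = u (h x y)) ->
  dominion U d -> forall x y, h (d x) (d y) = d (h x y).
Proof.
move=> Uh Dd x y.
pose W := ({ffun 'I_n * 'I_n -> bool} * {ffun 'I_n -> bool})%type.
pose act (s : full_trans n) (w : W) : W :=
  ([ffun z => w.1 (s z.1, s z.2)], [ffun z => w.2 (s z)]).
pose tau (w : W) : W := ([ffun z => w.1 z (+) w.2 (h z.1 z.2)], w.2).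
have actM s t w : act (s * t) w = act s (act t w).
  by congr pair; apply/ffunP => z; rewrite !ffunE.
have tauK : involutive tau.
  by case=> v a; congr pair; apply/ffunP => z; rewrite !ffunE addbK.
have Utau : {in U, forall u w, tau (act u w) = act u (tau w)}.
  move=> u Uu w; rewrite /tau /act /=; congr pair; apply/ffunP => z.
  by rewrite !ffunE /= Uh.
(* At [(x, y)], [tau (act d w)] evaluates to true and [act d (tau w)] to the test
   [h (d x) (d y) == d (h x y)]. *)
pose w : W := ([ffun=> false], [ffun z => z == d (h x y)]).
have := dominion_involution actM tauK Utau Dd w.
move/(congr1 (fun w : W => w.1 (x, y))).
by rewrite /= !ffunE /= eqxx => /esym/eqP.
Qed.

Lemma order_preservingP d :
  reflect {homo d : x y / (x <= y)%N} (order_preserving d).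
Proof.
apply: (iffP forallP) => [pd x y | pd x]; first exact/implyP/(forallP (pd x)).
by apply/forallP => y; apply/implyP; apply: pd.
Qed.

Definition fupdate d x y : full_trans n :=
  [ffun z => if z == x then y else d z].

Lemma fupdate_id_idem y z (e := fupdate [ffun x => x] y z) : e * e = e.
Proof.
apply/ffunP => t; rewrite !ffunE.
by case: (eqVneq t y) => [_|/negPf->//]; case: eqP.
Qed.

Lemma fupdate_order_preserving d x y : order_preserving d ->
    (forall z, (z < x)%N -> (d z <= y)%N) ->
    (forall z, (x < z)%N -> (y <= d z)%N) ->
  order_preserving (fupdate d x y).
Proof.
move=> /order_preservingP pd dlt dgt; apply/order_preservingP => s t st.
rewrite !ffunE; have [sx|sx] := eqVneq s x; have [tx|tx] := eqVneq t x => //.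
- by apply: dgt; rewrite ltn_neqAle -sx st eq_sym sx andbT.
- by apply: dlt; rewrite ltn_neqAle -tx st tx andbT.
- exact: pd.
Qed.

Lemma fupdate_id_order_preserving y z : (y <= z.+1)%N -> (z <= y.+1)%N ->
  order_preserving (fupdate [ffun x => x] y z).
Proof.
move=> yz zy; apply: fupdate_order_preserving => [|t ty|t ty].
- by apply/order_preservingP => s t st; rewrite !ffunE.
- by rewrite ffunE; lia.
- by rewrite ffunE; lia.
Qed.

(** After the update only [x] has the value [y], so sending [y] back to [d x] disturbs no other
    point. *)
Lemma fupdate_factor d x y : (forall z, z != x -> d z != y) ->
  d = fupdate d x y * fupdate [ffun z => z] y (d x).
Proof.
move=> dy; apply/ffunP => z; rewrite !ffunE.
by case: (eqVneq z x) => [->|/dy/negPf->]; rewrite ?eqxx.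
Qed.

End FullTransformations.

Section Pointed.
Variable n : nat.
Implicit Types (d e : full_trans n.+1) (x y z : 'I_n.+1).

Definition pointed_monotone d := order_preserving d && (d ord0 == ord0).

Lemma dominion_catalan_pointed d :
  dominion (catalan n.+1) d -> pointed_monotone d.
Proof.
move=> Dd; apply/andP; split; last first.
  apply/eqP/esym.
  pose h (_ _ : 'I_n.+1) : 'I_n.+1 := ord0.
  apply: (@dominion_preserves_op _ (catalan n.+1) h) Dd ord0 ord0.
  move=> u /andP[/forallP/(_ ord0) u0 _] x y.
  by apply: val_inj; apply/esym/eqP; rewrite -leqn0.
apply/order_preservingP => x y xy.
pose h x y := if (x <= y)%N then x else y.
have Uh (u : full_trans n.+1) : u \in catalan n.+1 ->
    forall s t, h (u s) (u t) = u (h s t).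
  move=> /andP[_ /order_preservingP pu] s t; rewrite /h.
  have [st|/ltnW ts] := leqP s t; first by rewrite pu.
  by case: leqP => // st; apply/val_inj/eqP; rewrite eqn_leq st pu.
have := dominion_preserves_op Uh Dd x y; rewrite /h xy.
by case: leqP => // + dyx; rewrite dyx ltnn.
Qed.

Lemma pointed_idem_dominion e :
  pointed_monotone e -> e * e = e -> dominion (catalan n.+1) e.
Proof.
move=> /andP[/order_preservingP pe /eqP e0] ee.
have eK x : e (e x) = e x by rewrite -[in RHS]ee ffunE.
pose m : full_trans n.+1 :=
  [ffun x : 'I_n.+1 => [arg min_(z < x | e z == e x) val z]].
(* The maximum is over a nonempty set, since [e] fixes [ord0]. *)
pose p : full_trans n.+1 :=
  [ffun x : 'I_n.+1 => [arg max_(z > ord0 | (z <= x)%N && (e z == z)) val z]].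
have mP x : e (m x) = e x /\ forall z, e z = e x -> (m x <= z)%N.
  by rewrite ffunE; case: arg_minnP => // i /eqP ei le; split=> // z /eqP/le.
have pP x : [/\ (p x <= x)%N, e (p x) = p x &
               forall z, (z <= x)%N -> e z = z -> (z <= p x)%N].
  rewrite ffunE; case: arg_maxnP => [|i /andP[ix /eqP ei] le].
    by rewrite e0 /=.
  by split=> // z zx ez; apply: le; rewrite zx ez /=.
clearbody m p.
have Cm : m \in catalan n.+1.
  apply/andP; split; first by apply/forallP => x; apply: (mP x).2.
  apply/order_preservingP => x y xy.
  have [emx mx] := mP x; have [emy my] := mP y.
  (* If [m y <= x], then [x] lies between two points of the kernel class of [y], hence in that
     class. *)
  case: (leqP (m y) x) => [/pe|/ltnW xm]; last exact: leq_trans (mx _ _) xm.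
  rewrite emy => eyx; apply: mx; rewrite emy; apply/val_inj/eqP.
  by rewrite eqn_leq eyx pe.
have Cp : p \in catalan n.+1.
  apply/andP; split; first by apply/forallP => x; case: (pP x).
  apply/order_preservingP => x y xy; have [px epx _] := pP x.
  by have [_ _] := pP y; apply=> //; apply: leq_trans xy.
have me : m * e = e by apply/ffunP => x; rewrite ffunE (mP x).1.
have epm : e * (p * m) = m.
  apply/ffunP => x; rewrite !ffunE.
  (* The fixed point [e x] of [e] is also fixed by [p], and it lies in the kernel class of [x]. *)
  have [pex _ le] := pP (e x).
  have -> : p (e x) = e x by apply/val_inj/eqP; rewrite eqn_leq pex le.
  by apply/val_inj/eqP; rewrite eqn_leq !(mP _).2 ?(mP _).1.
rewrite -[X in dominion _ X]me.
apply: (dominion_zigzag Cm (gpredM _ _ Cp Cm)) epm.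
suff -> : p * m * e = p by [].
by rewrite -mulgA me; apply/ffunP => x; rewrite ffunE; case: (pP x).
Qed.

(** Take the last point [x] moved down, if any: a later [z] has [d z >= z > x >= (d x).+1].
    Otherwise take the first point [x] moved up: an earlier [z] has [d z <= z < x <= (d x).-1]. *)
Lemma exists_adjacent_value d : order_preserving d -> d ord0 = ord0 ->
    d != [ffun x => x] ->
  exists x y, [/\ (0 < x)%N, (0 < y)%N,
    forall z, (z < x)%N -> (d z < y)%N,
    forall z, (x < z)%N -> (y < d z)%N &
    y = (d x).+1 :> nat /\ (y <= x)%N \/ d x = y.+1 :> nat /\ (x <= y)%N].
Proof.
move=> /order_preservingP pd d0 dN1.
have [x0 x0P|dge] := pickP (fun x => (d x < x)%N).
  have [x /= dx xmax] :=
    @arg_maxnP _ x0 (fun x => (d x < x)%N) (@nat_of_ord _) x0P.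
  have yE : (inord (d x).+1 : 'I_n.+1) = (d x).+1 :> nat.
    by rewrite inordK //; have := ltn_ord x; have := ltn_ord (d x); lia.
  exists x, (inord (d x).+1); rewrite yE; split; [lia | by [] | | | by left].
    by move=> z /ltnW/pd.
  move=> z xz; have := xmax z; rewrite /=; lia.
have [x0 x0P|dle] := pickP (fun x => (x < d x)%N); last first.
  case/eqP: dN1; apply/ffunP => x; rewrite ffunE; apply/val_inj.
  by have := dge x; have := dle x; rewrite /=; lia.
have [x /= dx xmin] :=
  @arg_minnP _ x0 (fun x => (x < d x)%N) (@nat_of_ord _) x0P.
have x_gt0 : (0 < x)%N.
  rewrite lt0n; apply/eqP => x0E; move: dx.
  by rewrite (_ : x = ord0) ?d0 //; apply: val_inj.
have yE : (inord (d x).-1 : 'I_n.+1) = (d x).-1 :> nat.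
  by rewrite inordK //; have := ltn_ord x; have := ltn_ord (d x); lia.
exists x, (inord (d x).-1); rewrite yE; split; [by [] | lia | | | right; lia].
  by move=> z zx; have := xmin z; lia.
by move=> z /ltnW/pd; lia.
Qed.

Lemma pointed_idem_product d : pointed_monotone d ->
  exists e es, (forall f, f \in e :: es -> pointed_monotone f /\ f * f = f) /\
    d = foldl *%g e es.
Proof.
(* With truncated subtraction each summand is the distance from [x] to [d x]; the update shortens
   exactly one of them, by one. *)
pose mu d := (\sum_x ((d x - x) + (x - d x)))%N.
have [k] := ubnP (mu d); elim: k => // k IHk in d * => lek Dd.
have [d1|dN1] := eqVneq d [ffun x => x].
  exists d, [::]; split=> // f; rewrite inE => /eqP->; split=> //.
  by rewrite d1; apply/ffunP => x; rewrite !ffunE.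
have /andP[pd /eqP d0] := Dd.
have [x [y [x_gt0 y_gt0 dlt dgt xy]]] := exists_adjacent_value pd d0 dN1.
have neq0 (z : 'I_n.+1) : (0 < z)%N -> (ord0 == z) = false.
  by move=> z_gt0; apply/eqP => z0; rewrite -z0 in z_gt0.
have Dd' : pointed_monotone (fupdate d x y).
  rewrite /pointed_monotone ffunE neq0 // d0 eqxx andbT.
  by apply: fupdate_order_preserving => // z zP; apply: ltnW; auto.
have De : pointed_monotone (fupdate [ffun z => z] y (d x)).
  rewrite /pointed_monotone !ffunE neq0 // eqxx andbT.
  by apply: fupdate_id_order_preserving; lia.
have lt_mu : (mu (fupdate d x y) < k)%N.
  rewrite ltnS in lek; apply: leq_trans lek; rewrite /mu.
  rewrite (bigD1 x) //= [X in (_ <= X)%N](bigD1 x) //=.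
  rewrite (eq_bigr (fun z => (d z - z) + (z - d z))%N) ?ffunE ?eqxx.
    by rewrite -addSn leq_add2r; lia.
  by move=> z /negPf zx; rewrite ffunE zx.
have [e [es [esP d'E]]] := IHk _ lt_mu Dd'.
exists e, (rcons es (fupdate [ffun z => z] y (d x))); split=> [f|].
  rewrite -rcons_cons mem_rcons inE => /predU1P[->|/esP//].
  by split=> //; apply: fupdate_id_idem.
rewrite foldl_rcons -d'E; apply: fupdate_factor => z; rewrite neq_ltn.
by case/orP=> [/dlt|/dgt]; rewrite -val_eqE neq_ltn => ->; rewrite ?orbT.
Qed.

End Pointed.

Theorem lemma4p6 (n : nat) (hn : (1 <= n)%N) :
  idempotent_generated (dominion (catalan n)).
Proof.
case: n hn => // n _ d /dominion_catalan_pointed/pointed_idem_product.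
move=> [e [es [esP dE]]]; exists e, es; split=> // f /esP[Df ff].
by split=> //; apply: pointed_idem_dominion.
Qed.
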